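(* For any integer $n \geq 3$, $$\sum_{\pi \in \mathcal{F}(n; 312)}x_{1}^{\alpha_{1}(\pi)} x_{2}^{\alpha_{2}(\pi)}\cdots x_{r}^{\alpha_{r}(\pi)} = \sum_{\pi' \in \mathcal{F}(n; 213)}x_{1}^{\alpha_{1}(\pi')} x_{2}^{\alpha_{2}(\pi')}\cdots x_{r}^{\alpha_{r}(\pi')},$$ where $\alpha_{i}(\pi)$ is the length of the $i$-th run of $\pi$ and, in each summand, $r$ denotes the number of runs of the permutation indexing that summand (so $r$ depends on the permutation). Consequently, putting all $x_{i} = 1$, $|\mathcal{F}(n; 213)| = |\mathcal{F}(n; 312)|$.
   Context: For a positive integer $n$, $[n]=\{1,\dots,n\}$, and a permutation $\sigma$ of $[n]$ is written as the word $\sigma(1)\sigma(2)\cdots\sigma(n)$. A run of $\sigma$ is a maximal block of consecutive positions on which $\sigma$ is increasing, so $\sigma$ is uniquely the concatenation of its runs (numbered from left to right); the starting point of a run is its first entry, and the length of a run is its number of entries. A flattened partition over $[n]$ is a permutation of $[n]$ whose runs, read from left to right, have increasing starting points. A permutation contains a pattern $\tau$ if it has a (not necessarily contiguous) subsequence order-isomorphic to $\tau$; otherwise it is $\tau$-avoiding. $\mathcal{F}(n;\tau)$ is the set of $\tau$-avoiding flattened partitions over $[n]$. Here $x_1,x_2,\dots$ are commuting indeterminates. *)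

(* Defs.v *)
From mathcomp Require Import all_boot all_order all_fingroup all_algebra.
From mathcomp Require Import mpoly.

Set Implicit Arguments.
Unset Strict Implicit.
Unset Printing Implicit Defensive.

(* Permutations of [n] are elements of 'S_n, which act on {0, .., n-1}; the
   word of a permutation is shifted by one so that its letters are 1, .., n. *)
Definition word n (s : 'S_n) : seq nat := [seq (s i).+1 | i <- enum 'I_n].

Fixpoint runs (w : seq nat) : seq (seq nat) :=
  if w is x :: w' then
    if runs w' is (y :: r) :: rs then
      if x < y then (x :: y :: r) :: rs else [:: x] :: (y :: r) :: rs
    else [:: [:: x]]
  else [::].

(* [runs w] cuts [w] into nonempty increasing blocks, and each block is maximal
   since its last letter is not smaller than the first letter of the next. *)
Lemma runs_correct w :
  all (fun r => (r != [::]) && sorted ltn r) (runs w) &&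
  sorted (fun r1 r2 => head 0 r2 <= last 0 r1) (runs w).
Proof.
elim: w => [//|x w /=].
case: (runs w) => [|[|y r] rs] //= /andP[/andP[pr ars] prs].
case: ltnP => xy /=; last by rewrite pr ars xy prs.
by rewrite xy pr ars /=; case: rs ars prs.
Qed.

Lemma flatten_runs w : flatten (runs w) = w.
Proof.
elim: w => [//|x w /=]; move: (runs_correct w).
by case: (runs w) => [|[|y r] rs] //= _ <- //; case: ifP.
Qed.

Definition num_runs n (s : 'S_n) : nat := size (runs (word s)).

(* [run_length s i] is the length of the (i+1)-st run of [s]. *)
Definition run_length n (s : 'S_n) (i : nat) : nat :=
  size (nth [::] (runs (word s)) i).

(* At most [n] indeterminates are needed for permutations of [n]. *)
Lemma num_runs_le n (s : 'S_n) : num_runs s <= n.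
Proof.
have {2}<- : size (word s) = n by rewrite size_map size_enum_ord.
rewrite /num_runs; elim: (word s) => [//|x w IHw] /=.
by case: (runs w) IHw => [//|[|y r] rs] //= IHw; case: ifP => _ //=; apply: leqW.
Qed.

Definition flattened n (s : 'S_n) : bool :=
  sorted ltn [seq head 0 r | r <- runs (word s)].

Definition order_isomorphic (u v : seq nat) : bool :=
  (size u == size v) &&
  [forall i : 'I_(size u), forall j : 'I_(size u),
    (nth 0 u i < nth 0 u j) == (nth 0 v i < nth 0 v j)].

Definition contains (w tau : seq nat) : bool :=
  [exists m : (size w).-tuple bool, order_isomorphic (mask m w) tau].

(* F(n; tau), for a pattern [tau] given by its word. *)
Definition flattened_avoiding (n : nat) (tau : seq nat) : {set 'S_n} :=
  [set s : 'S_n | flattened s && ~~ contains (word s) tau].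

Local Open Scope ring_scope.

(* x_1 ^ alpha_1 * .. * x_r ^ alpha_r, where 'X_i stands for x_(i+1). *)
Definition run_monomial n (s : 'S_n) : {mpoly int[n]} :=
  \prod_(i < n | (i < num_runs s)%N) 'X_i ^+ run_length s i.

(* Main.v *)
Require Import Defs.
From mathcomp Require Import all_boot all_order all_fingroup all_algebra.
From mathcomp Require Import mpoly zify.

(** In both patterns 312 and 213 the least letter stands in the middle, and this
makes the two classes parallel.  Cut a flattened word with several runs after
its first run, as [r ++ s :: w].  Being flattened makes [s] smaller than every
letter of [w].  Split [r] into the letters [L] below [s] and the letters [H]
above [s]; [L] is nonempty because [r] starts below [s], and [H] is nonempty
because [r] ends above [s].  A forbidden pattern that uses letters of [r] can
only take its first letter [x] in [H], and it can then take [s] as its middle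
letter; hence the word avoids the pattern if and only if [s :: w] does and, for
all [x] in [H] and [z] in [w],
  - [x < z] when the pattern is 312,
  - [z < x] when the pattern is 213.
So the increasing rearrangement of the whole word is [L], [s], [H], [w] sorted
in the first case, and [L], [s], [w] sorted, [H] in the second
([sorted_assemble]).  In both cases the two positive numbers [size L] and
[size H] can be prescribed freely, provided that at least one letter remains for
[s :: w], and they determine which letters form the first run ([peelP],
[flat_avoiding_cat]).

By induction on the number of runs, the sequence of the pairs
[(size L, size H)], one for each run but the last, is a code which is injective
on each of the two classes ([code_inj]) and whose image is described by a
condition [valid_code] that does not depend on the pattern ([code_valid],
[code_surj]).  The lengths of the runs can be read off the code, being
[size L + size H] ([code_lengthsE]).  Both sums of monomials are therefore the
same sum over valid codes.

The two cases are treated together, with a boolean [up] which is [true] for 312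
and [false] for 213. *)

Set Implicit Arguments.
Unset Strict Implicit.
Unset Printing Implicit Defensive.

(** * Cutting a word after its first run *)

Lemma runs_cat r w : r != [::] -> sorted ltn r -> w != [::] ->
  head 0 w <= last 0 r -> runs (r ++ w) = r :: runs w.
Proof.
move=> + + w0; elim: r => // x [|y r] IHr _ /=.
  move=> _ wx; have := flatten_runs w; move: (runs_correct w).
  case: (runs w) => [|[|y u] us] /=; [by move=> _ we; rewrite -we in w0 | by [] |].
  by move=> _ we; move: wx; rewrite -we /= leqNgt => /negbTE ->.
move=> /andP[xy yr] wr; have /= -> := IHr isT yr wr.
by rewrite xy.
Qed.

Lemma runs_sorted w : w != [::] -> sorted ltn w -> runs w = [:: w].
Proof.
elim: w => // x [|y w] IHw _ //= /andP[xy yw].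
by have /= -> := IHw isT yw; rewrite xy.
Qed.

Lemma runs_eq0 w : (runs w == [::]) = (w == [::]).
Proof.
case: w => //= x w; case: (runs w) => [|[|y r] rs] //.
by case: ifP.
Qed.

Lemma head_runs w : head 0 (head [::] (runs w)) = head 0 w.
Proof.
rewrite -{2}(flatten_runs w); move: (runs_correct w).
by case: (runs w) => [|[|x r] rs].
Qed.

(** In the second case the runs of the remaining word are the remaining runs of
[w], which lets proofs proceed by induction on words. *)
Variant runs_spec (w : seq nat) : seq (seq nat) -> Prop :=
| RunsOne of sorted ltn w : runs_spec w [:: w]
| RunsCons r s w1 of w = r ++ s :: w1 & r != [::] & sorted ltn r
    & s <= last 0 r : runs_spec w (r :: runs (s :: w1)).

Lemma runsP w : w != [::] -> runs_spec w (runs w).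
Proof.
rewrite -runs_eq0; move: (flatten_runs w) (runs_correct w) => + + w0; move: w0.
(* Cutting is undone by [flatten] as soon as the blocks satisfy the properties
   that [runs_correct] states. *)
suff runsK rs : all (fun r => (r != [::]) && sorted ltn r) rs ->
    sorted (fun r1 r2 => head 0 r2 <= last 0 r1) rs -> runs (flatten rs) = rs.
  case: (runs w) => // r [|[|s u] us] _ /=; rewrite ?andbF //.
    by rewrite cats0 => -> /andP[/andP[/andP[_ rw] _] _]; left.
  move=> <- /andP[/andP[/andP[r0 rs] /andP[us1 us2]] /andP[ur uss]].
  rewrite -[(s :: u) :: us]runsK /= ?us1 //.
  by right.
elim: rs => // r [|r1 rs] IHrs /=.
  by case/andP=> /andP[r0 rs] _ _; rewrite cats0 runs_sorted.
move=> /andP[/andP[r0 rs1] ars] /andP[h ps].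
have /= e := IHrs ars ps; rewrite runs_cat // ?e //.
  by case: (r1) ars.
by case: (r1) ars h.
Qed.

Definition flat w := sorted ltn [seq head 0 r | r <- runs w].

Lemma flat_cat r s w : r != [::] -> sorted ltn r -> s <= last 0 r ->
  flat (r ++ s :: w) = (head 0 r < s) && flat (s :: w).
Proof.
move=> r0 sr lr; rewrite /flat runs_cat //=.
have := head_runs (s :: w); rewrite /=.
by case: (runs w) => [|[|y u] us] //=; case: ifP.
Qed.

(** A letter is at least the starting point of its run, and the starting points
increase from [s] on. *)
Lemma flat_min s w : flat (s :: w) -> all (ltn s) w.
Proof.
have [m] := ubnP (size w); elim: m s w => // m IHm s w lem.
case: {-1}_ / (@runsP (s :: w) isT) (erefl (runs (s :: w))) => [|r t w1].
  by move=> /= + _ _; rewrite path_sortedE; [case/andP | apply: ltn_trans].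
case: r => // s' r /= [-> we] _ sr lr _; move: lem; rewrite {s}we => lem.
rewrite -cat_cons flat_cat //= => /andP[st /IHm tw].
rewrite all_cat /= st (order_path_min ltn_trans sr) /=.
apply: sub_all (tw _) => [x|]; first exact: ltn_trans.
by move: lem; rewrite size_cat /=; lia.
Qed.

(** * Avoidance and the first run *)

Definition before (up : bool) : rel nat := if up then ltn else gtn.

(** Since [y] is the least of the three letters, 312 and 213 differ only in how
[z] compares with [x]. *)
Definition avoids up (w : seq nat) := forall x y z,
  subseq [:: x; y; z] w -> y < x -> y < z -> ~~ before up z x.

(** The increasing rearrangement of a word of the class whose first run is
[L ++ H] and whose second run starts with [s]; the other letters form [T], and
avoidance puts all of them on the same side of [H]. *)
Definition assemble up (L : seq nat) (s : nat) (H T : seq nat) : seq nat :=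
  L ++ s :: (if up then H ++ T else T ++ H).

Lemma perm_assemble up L s H T :
  perm_eq (assemble up L s H T) ((L ++ H) ++ s :: T).
Proof.
rewrite /assemble -catA perm_cat2l perm_sym perm_catC /= perm_cons.
by case: up; rewrite // perm_catC.
Qed.

Lemma sorted_ltn_pairwise w : sorted ltn w = pairwise ltn w.
Proof. exact: sorted_pairwise ltn_trans w. Qed.

Lemma sorted_assemble up L s H T :
  sorted ltn (assemble up L s H T) =
  [&& sorted ltn (L ++ H), all (ltn^~ s) L, all (ltn s) H,
      sorted ltn (s :: T) & allrel (before up) H T].
Proof.
rewrite !sorted_ltn_pairwise /assemble !pairwise_cat /=.
rewrite allrel_consr.
have trans : all (ltn^~ s) L -> all (ltn s) T -> allrel ltn L T.
  move=> /allP Ls /allP sT; apply/allrelP => x y /Ls xs /sT; exact: ltn_trans.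
case aL: (all (ltn^~ s) L); last by rewrite /= ?andbF.
case aT: (all (ltn s) T); last first.
  by case: up; rewrite /= all_cat aT /= ?andbF.
case: up; rewrite /= all_cat aT pairwise_cat allrel_catr trans //=.
  case: (allrel ltn L H); case: (allrel ltn H T); rewrite /= ?andbF //=.
  by do !case: (all _ _); do !case: (pairwise _ _).
rewrite [allrel ltn T H]allrelC.
case: (allrel ltn L H); case: (allrel _ H T); rewrite /= ?andbF //=.
by do !case: (all _ _); do !case: (pairwise _ _).
Qed.

Lemma subseq_catE (u a b : seq nat) : subseq u (a ++ b) ->
  exists u1 u2, [/\ u = u1 ++ u2, subseq u1 a & subseq u2 b].
Proof.
case/subseqP => m sm ->; exists (mask (take (size a) m) a), (mask (drop (size a) m) b).
split; rewrite ?mask_subseq //.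
rewrite -{1}(cat_take_drop (size a) m) mask_cat // size_takel //.
by rewrite sm size_cat leq_addr.
Qed.

(** Let [x], [y], [z] be a forbidden pattern that meets the increasing word [r].
Then [x] is its only letter in [r], since [y < x], and replacing [y] by [s], the
least letter of the rest, gives another forbidden pattern. *)
Lemma avoids_run_cat up r s w : sorted ltn r -> all (ltn s) w ->
  uniq (r ++ s :: w) ->
  avoids up (r ++ s :: w) <->
  avoids up (s :: w) /\ allrel (before up) [seq x <- r | s < x] w.
Proof.
move=> sr sw; rewrite cat_uniq => /and3P[_ /hasPn rw _]; split=> [av|[av cr]].
  split=> [x y z xyz|].
    by apply: av; apply: subseq_trans xyz _; apply: suffix_subseq.
  apply/allrelP => x z; rewrite mem_filter => /andP[sx xr] zw.
  have := av x s z; rewrite -cat1s (cat_subseq (s1 := [:: x])) ?sub1seq //=; last first.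
    by rewrite eqxx sub1seq.
  move=> /(_ isT sx (allP sw _ zw)); move: (rw z); rewrite inE zw orbT => /(_ isT).
  have [<-|] := eqVneq x z; first by rewrite /= xr.
  by rewrite /before; case: (up) => /=; lia.
move=> x y z /subseq_catE[u1 [u2 [e su1 su2]]] yx yz.
case: u1 e su1 => [|x1 [|y1 u1]] /= e su1.
- by apply: av yx yz; rewrite e.
- move: e su1 su2 => [<- <-]; rewrite sub1seq => xr yzw.
  have zw : z \in w.
    move: yzw => /=; case: ifP => _; first by rewrite sub1seq.
    by move=> /cons_subseq; rewrite sub1seq.
  have sx : s < x.
    apply: leq_ltn_trans yx.
    have: y \in s :: w by apply: (mem_subseq yzw); rewrite inE eqxx.
    by rewrite inE => /predU1P[->//|/(allP sw)/ltnW].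
  have /(allrelP cr x z)/(_ zw) : x \in [seq x <- r | s < x] by rewrite mem_filter sx.
  by rewrite /before; case: (up) => /=; lia.
- case: e su1 => [<- <- _] su1.
  have: sorted ltn [:: x; y].
    apply: subseq_sorted ltn_trans _ _ _ sr; apply: subseq_trans su1.
    exact: prefix_subseq [:: x; y] u1.
  by rewrite /= andbT ltnNge ltnW.
Qed.

(** * The code of a word *)

(** As the letters are distinct, the second entry of a pair counts the letters of
the run above the next starting point. *)
Fixpoint run_code (rs : seq (seq nat)) : seq (nat * nat) :=
  if rs is r :: rs' then
    if rs' is r2 :: _ then
      let l := count (ltn^~ (head 0 r2)) r in (l, size r - l) :: run_code rs'
    else [::]
  else [::].

Definition code w := run_code (runs w).

(** The strict bound leaves at least one letter for the last run. *)
Fixpoint valid_code (c : seq (nat * nat)) (m : nat) : bool :=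
  if c is (l, h) :: c' then
    [&& 0 < l, 0 < h, l + h < m & valid_code c' (m - (l + h))]
  else true.

Fixpoint code_lengths (c : seq (nat * nat)) (m : nat) : seq nat :=
  if c is (l, h) :: c' then l + h :: code_lengths c' (m - (l + h))
  else [:: m].

Lemma code_lengthsE w : w != [::] ->
  code_lengths (code w) (size w) = [seq size r | r <- runs w].
Proof.
rewrite -runs_eq0 -[in size w](flatten_runs w) /code.
elim: (runs w) => // r [|r2 rs] IHrs _ /=; first by rewrite cats0.
by rewrite subnKC ?count_size // size_cat addKn IHrs.
Qed.

Definition flat_avoiding up w := flat w /\ avoids up w.

(** The run ends with a letter of [H], hence above [s], so that it is not
continued by [s]. *)
Lemma code_cat L H s w : L != [::] -> H != [::] ->
  sorted ltn (L ++ H) -> all (ltn^~ s) L -> all (ltn s) H ->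
  code ((L ++ H) ++ s :: w) = (size L, size H) :: code (s :: w).
Proof.
move=> L0 H0 sLH Ls sH; rewrite /code runs_cat //.
- have := head_runs (s :: w); have : runs (s :: w) != [::] by rewrite runs_eq0.
  case: (runs (s :: w)) => //= r2 rs _ ->; congr (_ :: _).
  have -> : count (ltn^~ s) (L ++ H) = size L.
    move: Ls; rewrite count_cat all_count => /eqP->; rewrite -[RHS]addn0; congr addn.
    apply/eqP; rewrite -leqn0 leqNgt -has_count; apply/hasPn => x.
    by move/(allP sH) => /= /ltnW; rewrite -leqNgt.
  by rewrite size_cat addKn.
- by case: (L) L0.
- case: H H0 sH {sLH} => // x H _ /allP/(_ (last x H)).
  by rewrite mem_last /= last_cat /= => /(_ isT)/ltnW.
Qed.

(** Here [V] is the increasing rearrangement of the word. *)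
Variant peel_spec up V : seq nat -> Prop :=
| PeelNil : peel_spec up V V
| PeelCons L s H T w of L != [::] & H != [::]
    & V = assemble up L s H T & perm_eq (s :: w) (s :: T)
    & flat_avoiding up (s :: w)
    & code ((L ++ H) ++ s :: w) = (size L, size H) :: code (s :: w)
  : peel_spec up V ((L ++ H) ++ s :: w).

Lemma sorted_filter_ltn s r : sorted ltn r -> s \notin r ->
  r = [seq x <- r | x < s] ++ [seq x <- r | s < x].
Proof.
move=> sr nsr; apply: (irr_sorted_eq ltn_trans ltnn) => //.
  rewrite sorted_ltn_pairwise pairwise_cat.
  rewrite -!sorted_ltn_pairwise !(sorted_filter ltn_trans) // !andbT.
  apply/allrelP => x y; rewrite !mem_filter => /andP[xs _] /andP[sy _].
  exact: ltn_trans xs sy.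
move=> x; rewrite mem_cat !mem_filter -andb_orl.
case xr: (x \in r); rewrite ?andbF // -neq_ltn.
by rewrite (memPn nsr).
Qed.

(** [V] and [assemble up L s H T], with [T] the sorted remaining letters, are
increasing words with the same letters, hence equal. *)
Lemma peelP up w V : V != [::] -> sorted ltn V -> perm_eq w V ->
  flat_avoiding up w -> peel_spec up V w.
Proof.
move=> V0 sV pwV [fw aw].
have uV : uniq V := sorted_uniq ltn_trans ltnn sV.
have uw : uniq w by rewrite (perm_uniq pwV).
have w0 : w != [::] by rewrite -size_eq0 (perm_size pwV) size_eq0.
have := runsP w0; case: {-1}_ / => [sw|r s w1 we r0 sr lr].
  by rewrite (irr_sorted_eq ltn_trans ltnn sw sV (perm_mem pwV)); left.
move: fw; rewrite we flat_cat // => /andP[hr fs].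
have sw1 := flat_min fs.
have nsr : s \notin r.
  by move: uw; rewrite we cat_uniq => /and3P[_ /hasPn/(_ s)]; rewrite inE eqxx => ->.
move: aw; rewrite we; rewrite we in uw; case/(avoids_run_cat _ sr sw1 uw) => av cr.
have rE := sorted_filter_ltn sr nsr.
set L := [seq x <- r | x < s] in rE; set H := [seq x <- r | s < x] in rE cr.
have Ls : all (ltn^~ s) L by apply/allP => x; rewrite mem_filter => /andP[].
have sH : all (ltn s) H by apply/allP => x; rewrite mem_filter => /andP[].
have L0 : L != [::].
  rewrite /L -size_eq0 size_filter -lt0n -has_count.
  by case: (r) r0 hr => //= x r' _ ->.
have H0 : H != [::].
  have: last 0 r \in H.
    rewrite mem_filter ltn_neqAle lr andbT.
    case: (r) r0 nsr => //= x r' _ /memPn/(_ _ (mem_last x r')).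
    by rewrite eq_sym => ->; rewrite mem_last.
  by apply: contraTneq => ->.
rewrite rE; have sTP : sorted ltn (s :: sort leq w1).
  rewrite /= path_sortedE; last exact: ltn_trans.
  rewrite all_sort sw1 ltn_sorted_uniq_leq sort_uniq (sort_sorted leq_total) andbT.
  by move: uw; rewrite cat_uniq /= => /and4P[_ _ _ ->].
right with (T := sort leq w1) => //.
- apply: (irr_sorted_eq ltn_trans ltnn) => //.
    rewrite sorted_assemble -rE sr Ls sH sTP /=.
    by apply/allrelP => x y xH; rewrite mem_sort => /(allrelP cr _ _ xH).
  move=> x; rewrite (perm_mem (perm_assemble _ _ _ _ _)) -rE -(perm_mem pwV) we.
  by rewrite !mem_cat !inE mem_sort.
- by rewrite perm_cons perm_sym perm_sort.
- by rewrite code_cat // -rE.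
Qed.

(** Converse of [peelP]: a first run cut from [V] in the prescribed way can be
followed by any word of the class on the remaining letters. *)
Lemma flat_avoiding_cat up L s H T w : L != [::] -> H != [::] ->
  sorted ltn (assemble up L s H T) -> perm_eq (s :: w) (s :: T) ->
  flat_avoiding up (s :: w) ->
  [/\ flat_avoiding up ((L ++ H) ++ s :: w),
      perm_eq ((L ++ H) ++ s :: w) (assemble up L s H T) &
      code ((L ++ H) ++ s :: w) = (size L, size H) :: code (s :: w)].
Proof.
move=> L0 H0 sV pwT [fw aw].
have pV : perm_eq ((L ++ H) ++ s :: w) (assemble up L s H T).
  by rewrite perm_sym (perm_trans (perm_assemble _ _ _ _ _)) // perm_cat2l perm_sym.
have uV : uniq (assemble up L s H T) := sorted_uniq ltn_trans ltnn sV.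
rewrite -(perm_uniq pV) in uV.
move: sV; rewrite sorted_assemble => /and5P[sLH Ls sH sT cr].
split=> //; last exact: code_cat.
split.
  rewrite flat_cat //.
  - by case: (L) L0 Ls => //= x L' _ /andP[->].
  - by case: (L) L0.
  - case: H H0 sH {sLH pV uV cr} => // x H _ /allP/(_ (last x H)).
    by rewrite mem_last /= last_cat /= => /(_ isT)/ltnW.
apply/avoids_run_cat => //; first exact: flat_min.
split=> //; apply/allrelP => x z; rewrite mem_filter mem_cat => /andP[sx].
move=> /orP[/(allP Ls)/ltnW /=|xH]; first by rewrite leqNgt sx.
move=> zw; apply: (allrelP cr) => //.
by rewrite perm_cons in pwT; rewrite -(perm_mem pwT).
Qed.

(** The first pair of the code gives the lengths of [L] and [H], which determine
these blocks as pieces of the increasing word [V]. *)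
Lemma code_inj up V w w' : sorted ltn V ->
  perm_eq w V -> perm_eq w' V -> flat_avoiding up w -> flat_avoiding up w' ->
  code w = code w' -> w = w'.
Proof.
have [m] := ubnP (size V); elim: m V w w' => // m IHm V w w' ltm sV pw pw' fw fw'.
have [V0|V0] := eqVneq V [::].
  by move: pw pw'; rewrite V0 => /perm_nilP-> /perm_nilP->.
have codeV : code V = [::] by rewrite /code runs_sorted.
case: (peelP V0 sV pw fw) => [|L s H T w1 L0 H0 VE pwT fw1 ->];
case: (peelP V0 sV pw' fw') => [|L' s' H' T' w1' L0' H0' VE' pwT' fw1' ->];
  rewrite ?codeV // => -[eL eH ec].
move: (VE'); rewrite {1}VE => /eqP; rewrite eqseq_cat // eqseq_cons.
move=> /and3P[/eqP eqL /eqP eqs /eqP e]; subst L' s'.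
have [eqH eqT] : H = H' /\ T = T'.
  have eT : size T = size T'.
    move/(congr1 size): e; case: ifP => _; rewrite !size_cat eH.
      by move/addnI.
    by move/addIn.
  by case: ifP e => _ /eqP; rewrite eqseq_cat // => /andP[/eqP-> /eqP->].
subst H' T'; congr (_ ++ _).
apply: (IHm (s :: T)) ec => //.
  move: ltm; rewrite VE (perm_size (perm_assemble _ _ _ _ _)) !size_cat /=.
  by case: (L) L0 => //= *; lia.
by move: sV; rewrite VE sorted_assemble => /and5P[].
Qed.

Lemma code_valid up V w : sorted ltn V -> perm_eq w V ->
  flat_avoiding up w -> valid_code (code w) (size V).
Proof.
have [m] := ubnP (size V); elim: m V w => // m IHm V w ltm sV pw fw.
have [V0|V0] := eqVneq V [::].
  by move: pw; rewrite V0 => /perm_nilP->.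
case: (peelP V0 sV pw fw) => [|L s H T w1 L0 H0 VE pwT fw1 ->].
  by rewrite /code runs_sorted.
have sE : size V = size L + size H + size (s :: T).
  by rewrite VE (perm_size (perm_assemble _ _ _ _ _)) !size_cat.
rewrite [valid_code _ _]/= !lt0n !size_eq0 L0 H0 sE addKn.
rewrite -[X in X < _]addn0 ltn_add2l /=.
apply: (IHm (s :: T)) => //.
  move: L0; rewrite -size_eq0; lia.
by move: sV; rewrite VE sorted_assemble => /and5P[].
Qed.

Lemma assemble_split up l h V : l + h < size V ->
  exists L s H T, [/\ V = assemble up L s H T, size L = l & size H = h].
Proof.
move=> lth; have lV : l < size V by lia.
exists (take l V), (nth 0 V l).
pose U := drop l.+1 V.
have hU : h <= size U by rewrite size_drop; lia.
have sL : size (take l V) = l by rewrite size_takel // ltnW.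
rewrite -{1}(cat_take_drop l V) (drop_nth 0) // -/U.
case: up.
  by exists (take h U), (drop h U); rewrite /assemble cat_take_drop sL size_takel.
exists (drop (size U - h) U), (take (size U - h) U).
by rewrite /assemble cat_take_drop [size (drop _ _)]size_drop subKn.
Qed.

(** The first pair of the code tells how to cut [V] into [L], [s], [H] and [T]; a
word on [s :: T] given by the rest of the code starts with its least letter [s],
so that the run [L ++ H] can be put in front of it. *)
Lemma code_surj up V c : V != [::] -> sorted ltn V -> valid_code c (size V) ->
  exists w, [/\ perm_eq w V, flat_avoiding up w & code w = c].
Proof.
elim: c V => [|[l h] c IHc] V V0 sV /=.
  move=> _; exists V; rewrite /code runs_sorted //; split=> //.
  split; first by rewrite /flat runs_sorted.
  move=> x y z /subseq_sorted-/(_ _ ltn_trans sV) /=; lia.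
case/and4P=> l0 h0 /(assemble_split up)[L [s [H [T [VE sL sH]]]]] vc.
have sT : sorted ltn (s :: T) by move: sV; rewrite VE sorted_assemble => /and5P[].
have [//|//||w [pw fw cw]] := IHc (s :: T).
  move: vc; rewrite VE (perm_size (perm_assemble _ _ _ _ _)) !size_cat sL sH.
  by rewrite addKn.
have [w1 we] : exists w1, w = s :: w1.
  case: w pw fw {cw} => [/perm_size//|t w1] pw [/flat_min tw1 _].
  exists w1; congr (_ :: _); apply/eqP; rewrite eqn_leq.
  have: s \in t :: w1 by rewrite (perm_mem pw) inE eqxx.
  have: t \in s :: T by rewrite -(perm_mem pw) inE eqxx.
  rewrite !inE => /orP[/eqP-> | /(allP (order_path_min ltn_trans sT)) /= st].
    by rewrite leqnn.
  by case/orP=> [/eqP->|/(allP tw1) /= ts]; [rewrite leqnn | lia].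
subst w; exists ((L ++ H) ++ s :: w1).
have L0 : L != [::] by rewrite -size_eq0 sL -lt0n.
have H0 : H != [::] by rewrite -size_eq0 sH -lt0n.
rewrite VE in sV *; have [fw' pw' ->] := flat_avoiding_cat L0 H0 sV pw fw.
by split=> //; rewrite sL sH cw.
Qed.

(** * Permutations *)

Lemma wordP n w : reflect (exists s : 'S_n, w = word s) (perm_eq w (iota 1 n)).
Proof.
have sz : size (iota 1 n) == n by rewrite size_iota.
have E (s : 'S_n) : word s = [tuple tnth (Tuple sz) (s i) | i < n].
  apply/eq_map => i.
  by rewrite (tnth_nth 0) nth_iota ?add1n.
apply: (iffP (@tuple_permP _ _ _ (Tuple sz))) => [[s ->]|[s ->]]; exists s; rewrite ?E //.
Qed.

Lemma word_inj n : injective (@word n).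
Proof.
move=> s t /eq_in_map e; apply/permP => i.
by have /(_ (mem_enum _ _))[/val_inj] := e i.
Qed.

Definition pattern (up : bool) : seq nat := if up then [:: 3; 1; 2] else [:: 2; 1; 3].

Lemma order_isomorphic3 up u : order_isomorphic u (pattern up) ->
  exists x y z, [/\ u = [:: x; y; z], y < x, y < z & before up z x].
Proof.
have sp : size (pattern up) = 3 by case: up.
rewrite /order_isomorphic sp; case: u => [|x [|y [|z [|]]]] //= /forallP iso.
exists x, y, z.
have /forallP i1 := iso (@Ordinal 3 1 isT); have /eqP := i1 (@Ordinal 3 0 isT).
have /eqP := i1 (@Ordinal 3 2 isT).
have /forallP i2 := iso (@Ordinal 3 2 isT); have /eqP := i2 (@Ordinal 3 0 isT).
have /forallP i0 := iso (@Ordinal 3 0 isT); have /eqP := i0 (@Ordinal 3 2 isT).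
by case: up {sp iso i0 i1 i2} => /= xz zx yz yx; split; rewrite ?yx ?yz ?xz ?zx.
Qed.

Lemma isomorphic3 up x y z : y < x -> y < z -> before up z x ->
  order_isomorphic [:: x; y; z] (pattern up).
Proof.
move=> yx yz zx; rewrite /order_isomorphic; apply/andP; split; first by case: up zx.
apply/forallP => -[[|[|[|//]]] lti]; apply/forallP => -[[|[|[|//]]] ltj];
  by case: up zx; rewrite /before /= => zx; rewrite ?ltnn ?zx ?yx ?yz //;
     rewrite ltnNge ltnW.
Qed.

Lemma avoidsP up w : reflect (avoids up w) (~~ contains w (pattern up)).
Proof.
apply: (iffP idP) => [nc x y z /subseqP[m sm e] yx yz|av].
  apply: contra nc => zx; apply/existsP.
  have sm' : size m == size w by rewrite sm.
  by exists (Tuple sm'); rewrite /= -e isomorphic3.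
apply/existsP => -[m /order_isomorphic3[x [y [z [e yx yz zx]]]]].
have := av x y z; rewrite -e mask_subseq => /(_ isT yx yz).
by rewrite zx.
Qed.

Lemma mem_flattened_avoiding n up (s : 'S_n) :
  reflect (flat_avoiding up (word s)) (s \in flattened_avoiding n (pattern up)).
Proof.
rewrite inE; apply: (iffP andP) => [[fs /avoidsP]|[fs /avoidsP]];
  by split.
Qed.

Definition codes n up :=
  [seq code (word s) | s in flattened_avoiding n (pattern up)].

Lemma codes_uniq n up : uniq (codes n up).
Proof.
rewrite map_inj_in_uniq ?enum_uniq // => s t; rewrite !mem_enum.
move=> /mem_flattened_avoiding fs /mem_flattened_avoiding ft e; apply: word_inj.
by apply: (code_inj (iota_ltn_sorted 1 n)) fs ft e;
  apply/wordP; [exists s | exists t].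
Qed.

Lemma mem_codes n up c : 0 < n -> (c \in codes n up) = valid_code c n.
Proof.
move=> n0; apply/imageP/idP => [[s /mem_flattened_avoiding fs ->]|vc].
  rewrite -{2}(size_iota 1 n); apply: code_valid fs; first exact: iota_ltn_sorted.
  by apply/wordP; exists s.
rewrite -{1}(size_iota 1 n) in vc.
have [|w [/wordP[s ->] fs <-]] := @code_surj up _ _ _ (iota_ltn_sorted 1 n) vc.
  by rewrite -size_eq0 size_iota -lt0n.
by exists s => //; apply/mem_flattened_avoiding.
Qed.

(** The equidistribution itself: validity of a code does not mention the
pattern. *)
Lemma perm_codes n : 0 < n -> perm_eq (codes n true) (codes n false).
Proof.
move=> n0; apply: uniq_perm; rewrite ?codes_uniq // => c.
by rewrite !mem_codes.
Qed.

Local Open Scope ring_scope.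

Definition code_monomial n (c : seq (nat * nat)) : {mpoly int[n]} :=
  let a := code_lengths c n in \prod_(i < n | (i < size a)%N) 'X_i ^+ nth 0%N a i.

Lemma run_monomialE n (s : 'S_n) : (0 < n)%N ->
  run_monomial s = code_monomial n (code (word s)).
Proof.
move=> n0; have sw : size (word s) = n by rewrite size_map size_enum_ord.
have eL : code_lengths (code (word s)) n = [seq size r | r <- runs (word s)].
  by rewrite -code_lengthsE ?sw // -size_eq0 sw -lt0n.
rewrite /code_monomial eL size_map /run_monomial.
by apply: eq_bigr => i lti; rewrite (nth_map [::]).
Qed.

Theorem theorem2p5 (n : nat) (hn : (3 <= n)%N) :
  (\sum_(s in flattened_avoiding n [:: 3; 1; 2]%N) run_monomial s
   = \sum_(s in flattened_avoiding n [:: 2; 1; 3]%N) run_monomial s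
     :> {mpoly int[n]})
  /\ #|flattened_avoiding n [:: 2; 1; 3]%N|
     = #|flattened_avoiding n [:: 3; 1; 2]%N|.
Proof.
have n0 : (0 < n)%N by apply: leq_trans hn.
have pc := perm_codes n0.
split; last by move/perm_size: pc; rewrite !size_image.
have sumE up : \sum_(s in flattened_avoiding n (pattern up)) run_monomial s =
    \sum_(c <- codes n up) code_monomial n c.
  by rewrite big_image; apply: eq_bigr => s _; apply: run_monomialE.
by rewrite (sumE true) (sumE false); apply: perm_big.
Qed.
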